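(* Let $f\in\mathcal{F}_L$ with a minimizer $x^*$, let $0<s\le 1/L$, and consider the algorithm $$x_{k+1}=x_k+\frac{2}{k}(v_k-x_{k+1})-s\nabla f(x_k),$$ $$v_{k+1}=v_k-\frac12 sk\,\nabla f(x_{k+1})-s\nabla f(x_{k+1}),$$ initialized with $v_0=x_1\in\mathbb{R}^d$. Then the sequence $x_k$ satisfies $$\frac{k^3s^2}{12}\min_{0\le i\le k-1}\|\nabla f(x_i)\|^2\le\|x_1-x^*\|^2\qquad(k\ge 2),$$ $$\frac{sk(k+2)}{2}\big(f(x_k)-f(x^* )\big)\le\|x_1-x^*\|^2\qquad(k\ge 1).$$
   Context: $\mathcal{F}_L$ is the class of convex $L$-smooth functions $f:\mathbb{R}^d\to\mathbb{R}$ (the gradient is $L$-Lipschitz). $\|\cdot\|$ is the Euclidean norm. The algorithm starts from $x_1$ with $v_0=x_1$: the second update line is applied for $k\ge 0$ (so $v_1=x_1-s\nabla f(x_1)$), and the first update line, which is implicit in $x_{k+1}$, is applied for $k\ge 1$ (for $k=0$, multiplied by $k$, it is the initialization $v_0=x_1$). The point $x_0$ is not used by the algorithm and may be taken arbitrary. *)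

(* Defs.v *)
From mathcomp Require Import all_boot all_order all_algebra.
From mathcomp Require Import all_classical all_reals all_analysis.

Set Implicit Arguments.
Unset Strict Implicit.
Unset Printing Implicit Defensive.

Import Order.TTheory GRing.Theory Num.Theory.
Import numFieldNormedType.Exports.

Local Open Scope classical_set_scope.
Local Open Scope ring_scope.

(* The library's norm `|u| on 'rV[R]_d is the sup norm, hence a separate
   Euclidean norm. *)
Definition enorm (R : realType) (d : nat) (u : 'rV[R]_d) : R :=
  Num.sqrt (\sum_(i < d) u 0 i ^+ 2).

(* Meaningful only where f is differentiable (see smooth_convex). *)
Definition grad (R : realType) (d : nat) (f : 'rV[R]_d -> R) (x : 'rV[R]_d) :
    'rV[R]_d :=
  \row_(i < d) 'D_(delta_mx 0 i) f x.

(* The class F_L. Differentiability does not depend on the choice of a norm on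
   'rV[R]_d, but the Lipschitz bound is with respect to the Euclidean norm. *)
Definition smooth_convex (R : realType) (d : nat) (L : R)
    (f : 'rV[R]_d -> R) : Prop :=
  [/\ convex_function [set: 'rV[R]_d] f,
      forall x, differentiable f x
    & forall x y, enorm (grad f x - grad f y) <= L * enorm (x - y)].

Definition minimizer (R : realType) (d : nat) (f : 'rV[R]_d -> R)
    (xstar : 'rV[R]_d) : Prop :=
  forall y, f xstar <= f y.

(* x 0 is unconstrained. The x-update is required for k >= 1 only: its k = 0
   instance, multiplied by k, is the initialization v 0 = x 1. *)
Definition algorithm (R : realType) (d : nat) (f : 'rV[R]_d -> R) (s : R)
    (x v : nat -> 'rV[R]_d) : Prop :=
  [/\ v 0%N = x 1%N,
      forall k : nat, (1 <= k)%N ->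
        x k.+1 = x k + (2 / k%:R) *: (v k - x k.+1) - s *: grad f (x k)
    & forall k : nat,
        v k.+1 = v k - (2^-1 * s * k%:R) *: grad f (x k.+1)
                 - s *: grad f (x k.+1)].

(* Main.v *)
Require Import Defs.
From mathcomp Require Import all_boot all_order all_algebra.
From mathcomp Require Import all_classical all_reals all_analysis.
From mathcomp Require Import ring lra.

Import Order.TTheory GRing.Theory Num.Theory.
Import numFieldNormedType.Exports.

Local Open Scope ring_scope.

(** Write g_k for the gradient at x_k and F_k = f(x_k) - f(xstar).  The proof is
    a Lyapunov argument: the energy
      E_k = s k (k+2) / 4 * F_k + |v_k - xstar|^2 / 2
    satisfies E_(k+1) + s^2 k (k+2) / 8 * |g_k|^2 <= E_k ([energy_step]).
    Since v_0 = x_1 and the coefficient of F_0 vanishes, E_0 is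
    |x_1 - xstar|^2 / 2.  Telescoping ([energy_telescope]) gives both rates:
    dropping the squared distance and the gradient terms from E_k leaves the
    bound on F_k, and dropping E_k leaves a bound on the weighted sum of the
    |g_i|^2, i < k, hence on their minimum, because the weights i (i+2) add up
    to k (k-1) (2k+5) / 6, which is at least k^3 / 3 once k >= 2.

    The energy decreases because of the interpolation inequality for convex
    functions with (1/s)-Lipschitz gradient,
      f(x) + <g(x), y - x> + s/2 |g(x) - g(y)|^2 <= f(y)
    ([cocoercive]), used at the pairs (x_(k+1), xstar) and (x_(k+1), x_k).
    With the resulting bounds, the |g_(k+1)|^2 terms cancel exactly; this is
    what the weights in the algorithm and in E_k are tuned for.  The
    interpolation inequality itself follows from the tangent inequality
    ([convex_tangent]) and the descent lemma ([descent]), both obtained by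
    restricting f to a line. *)

(** * The Euclidean inner product *)

Definition dot {R : realType} {d : nat} (u v : 'rV[R]_d) : R :=
  \sum_(i < d) u 0 i * v 0 i.

Section Dot.
Context {R : realType} {d : nat}.
Implicit Types (u v w h : 'rV[R]_d) (a c : R).

Lemma dotC u v : dot u v = dot v u.
Proof. by apply: eq_bigr => i _; rewrite mulrC. Qed.

Lemma dotDl u v w : dot (u + v) w = dot u w + dot v w.
Proof. by rewrite -big_split; apply: eq_bigr => i _; rewrite mxE mulrDl. Qed.

Lemma dotZl a u v : dot (a *: u) v = a * dot u v.
Proof. by rewrite mulr_sumr; apply: eq_bigr => i _; rewrite mxE mulrA. Qed.

Lemma dotNl u v : dot (- u) v = - dot u v.
Proof. by rewrite -scaleN1r dotZl mulN1r. Qed.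

Lemma dotDr u v w : dot u (v + w) = dot u v + dot u w.
Proof. by rewrite !(dotC u) dotDl. Qed.

Lemma dotZr a u v : dot u (a *: v) = a * dot u v.
Proof. by rewrite !(dotC u) dotZl. Qed.

Lemma dotNr u v : dot u (- v) = - dot u v.
Proof. by rewrite !(dotC u) dotNl. Qed.

Definition dotE := (dotDl, dotDr, dotNl, dotNr, dotZl, dotZr).

Lemma dot_sqrBZ u v a :
  dot (u - a *: v) (u - a *: v) = dot u u - 2 * a * dot v u + a ^+ 2 * dot v v.
Proof. by rewrite !dotE (dotC u v); ring. Qed.

Lemma dot_ge0 u : 0 <= dot u u.
Proof. by apply: sumr_ge0 => i _; rewrite -expr2 sqr_ge0. Qed.

Lemma dot_eq0 u : dot u u = 0 -> u = 0.
Proof.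
move=> /eqP; rewrite psumr_eq0; last by move=> i _; rewrite -expr2 sqr_ge0.
move=> /allP u0; apply/rowP => i; rewrite mxE.
by have := u0 i (mem_index_enum _); rewrite /= mulf_eq0 orbb => /eqP.
Qed.

Lemma enorm_sqr u : enorm u ^+ 2 = dot u u.
Proof.
rewrite sqr_sqrtr; first by apply: eq_bigr => i _; rewrite expr2.
by apply: sumr_ge0 => i _; rewrite sqr_ge0.
Qed.

(** The form in which the Cauchy-Schwarz inequality enters the descent lemma;
    expanding |u - c h|^2 >= 0 is enough. *)
Lemma dot_le_of_enorm c u h : 0 < c -> enorm u <= c * enorm h ->
  dot u h <= c * enorm h ^+ 2.
Proof.
move=> c0 uh; rewrite enorm_sqr.
have : enorm u ^+ 2 <= (c * enorm h) ^+ 2.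
  by rewrite ler_pXn2r// nnegrE ?mulr_ge0 ?sqrtr_ge0// ltW.
rewrite exprMn !enorm_sqr => uh2.
have := dot_ge0 (u - c *: h); rewrite dot_sqrBZ (dotC h u) => sq.
by rewrite -(ler_pM2l c0); nra.
Qed.

End Dot.

(** * Convex functions with Lipschitz gradient *)

Section Smooth.
Context {R : realType} {d : nat}.
Implicit Types (f : 'rV[R]_d -> R) (x y h : 'rV[R]_d) (L : R).

Lemma derive_grad f x h : differentiable f x -> 'D_h f x = dot (grad f x) h.
Proof.
move=> df; rewrite deriveE// {1}(row_sum_delta h) linear_sum.
apply: eq_bigr => i _.
by rewrite linearZ /= /grad mxE deriveE// mulrC.
Qed.

Lemma is_derive_line f x h (t : R) : differentiable f (x + t *: h) ->
  is_derive t 1 (fun r : R => f (x + r *: h)) (dot (grad f (x + t *: h)) h).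
Proof.
move=> df; rewrite -derive_grad//.
(* Both derivatives are limits of the same difference quotient. *)
have E : (fun r : R => r^-1 *: (((fun r : R => f (x + r *: h)) \o shift t)
                                  (r *: (1 : R)) - f (x + t *: h)))
   = (fun r : R => r^-1 *: ((f \o shift (x + t *: h)) (r *: h)
                            - f (x + t *: h))).
  apply/funext => r /=; congr (_ *: (f _ - _)).
  by rewrite scalerDl [r *: 1]mulr1 addrCA.
have dfh : derivable f (x + t *: h) h by exact: diff_derivable.
split; first by rewrite /derivable E.
by rewrite /derive E.
Qed.

(** By the mean value theorem: along the line the difference of the two sides
    has derivative <g(x + t h) - g(x), h> - L t |h|^2, which is nonpositive by
    the Lipschitz bound. *)
Lemma descent f L x h : 0 < L ->
  (forall x, differentiable f x) ->
  (forall x y, enorm (grad f x - grad f y) <= L * enorm (x - y)) ->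
  f (x + h) <= f x + dot (grad f x) h + L / 2 * enorm h ^+ 2.
Proof.
move=> L0 df lip.
pose phi (t : R) := f (x + t *: h)
  - (dot (grad f x) h * t + L / 2 * enorm h ^+ 2 * t ^+ 2).
pose dphi (t : R) := dot (grad f (x + t *: h)) h
  - (dot (grad f x) h + L / 2 * enorm h ^+ 2 * (2 * t)).
have dphiE (t : R) : is_derive t 1 phi (dphi t).
  rewrite /phi /dphi.
  have ? := is_derive_line f x h t (df _).
  apply: is_deriveB => //.
  apply: is_derive_eq.
  by rewrite /GRing.scale /=; ring.
have cphi : {within `[0, 1], continuous phi}%classic.
  apply: continuous_subspaceT => t.
  apply: differentiable_continuous; apply/derivable1_diffP.
  exact: ex_derive.
have [t t01] := MVT ltr01 (fun t _ => dphiE t) cphi.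
move: t01; rewrite in_itv /= => /andP[t0 t1].
have dphi0 : dphi t <= 0.
  have : dot (grad f (x + t *: h) - grad f x) h <= L * t * enorm h ^+ 2.
    apply: dot_le_of_enorm; first exact: mulr_gt0.
    apply: le_trans (lip _ _) _.
    rewrite -mulrA ler_pM2l// [x + _]addrC addrK.
    rewrite -(@ler_pXn2r _ 2)// ?nnegrE ?mulr_ge0 ?sqrtr_ge0 ?(ltW t0)//.
    by rewrite exprMn !enorm_sqr !dotE mulrA expr2.
  rewrite /dphi !dotE; lra.
rewrite subr0 mulr1 /phi scale0r scale1r !addr0; lra.
Qed.

Lemma convex_line f x y (t : R) : convex_function [set: 'rV[R]_d] f ->
  0 < t -> t < 1 -> f (x + t *: (y - x)) <= f x + t * (f y - f x).
Proof.
move=> cf t0 t1.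
have t01 : Itv.spec (@Itv.num_sem R) (Itv.Real `[Posz 0, Posz 1]%Z) t.
  rewrite /= /Itv.num_sem /= in_itv /= ger0_real; last exact: ltW.
  by rewrite !ltW.
pose t' : {i01 R} := Itv.mk t01.
have := cf t' y x; rewrite !inE => /(_ I I).
rewrite convRE /=.
have -> : conv t' (y : convex_lmodType _) x = x + t *: (y - x).
  by rewrite /conv /= /unstable.onem scalerBl scale1r scalerBr addrCA.
rewrite /unstable.onem; lra.
Qed.

Lemma convex_tangent f x y : convex_function [set: 'rV[R]_d] f ->
  differentiable f x -> f x + dot (grad f x) (y - x) <= f y.
Proof.
move=> cf df; rewrite -lerBrDl -derive_grad//.
have dh : derivable f x (y - x) by exact: diff_derivable.
(* Convexity bounds the difference quotient for positive steps only. *)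
apply: (cvgr_to_le (cvg_dnbhs_at_right dh)).
near=> t.
have t0 : 0 < t by near: t; exact: nbhs_right_gt.
have t1 : t < 1 by near: t; exact: nbhs_right_lt.
rewrite /= /GRing.scale /= ler_pdivrMl// [_ *: _ + x]addrC.
by rewrite lerBlDl; exact: convex_line.
Unshelve. all: by end_near. Qed.

(** Compare two bounds at z = y - (g(y) - g(x)) / L: the tangent at x bounds
    f(z) from below, the descent lemma at y bounds it from above.  This z
    minimizes the gap between the two bounds. *)
Lemma cocoercive f L x y : 0 < L -> smooth_convex L f ->
  f x + dot (grad f x) (y - x)
    + (2 * L)^-1 * dot (grad f x - grad f y) (grad f x - grad f y) <= f y.
Proof.
move=> L0 [cf df lip].
have := convex_tangent f x (y + L^-1 *: (grad f x - grad f y)) cf (df x).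
have := descent f L y (L^-1 *: (grad f x - grad f y)) L0 df lip.
rewrite enorm_sqr (addrAC y); move: (y - x) => w.
rewrite !dotE (dotC (grad f y) (grad f x)).
set gx := dot (grad f x) (grad f x); set gy := dot (grad f y) (grad f y).
set gg := dot (grad f x) (grad f y).
move=> up low; have := le_trans low up; rewrite -subr_ge0 => gap.
rewrite -subr_ge0; apply: le_trans gap _; rewrite le_eqVlt; apply/orP; left.
by apply/eqP; field; rewrite gt_eqF.
Qed.

Lemma grad_minimizer f L x : 0 < L -> smooth_convex L f ->
  minimizer f x -> grad f x = 0.
Proof.
move=> L0 [cf df lip] xmin; apply: dot_eq0; apply/eqP.
rewrite eq_le dot_ge0 andbT.
(* A gradient step of length 1/L decreases f by at least |g|^2 / (2 L). *)
have := descent f L x (- (L^-1 *: grad f x)) L0 df lip.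
rewrite enorm_sqr !dotE => /(le_trans (xmin _)).
rewrite -subr_ge0; set g := dot _ _.
rewrite [X in 0 <= X](_ : _ = (2 * L)^-1 * - g); last first.
  by field; rewrite gt_eqF.
by rewrite pmulr_rge0 ?oppr_ge0// invr_gt0 mulr_gt0.
Qed.

Lemma smooth_convex_weaken f L L' : L <= L' ->
  smooth_convex L f -> smooth_convex L' f.
Proof.
move=> LL' [cf df lip]; split=> // x y.
by apply: le_trans (lip x y) _; rewrite ler_wpM2r ?sqrtr_ge0.
Qed.

End Smooth.

(** * The energy of the algorithm *)

Definition energy {R : realType} {d : nat} (f : 'rV[R]_d -> R) (s : R)
    (xstar : 'rV[R]_d) (x v : nat -> 'rV[R]_d) (k : nat) : R :=
  s * k%:R * (k%:R + 2) / 4 * (f (x k) - f xstar)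
  + dot (v k - xstar) (v k - xstar) / 2.

Section Energy.
Context {R : realType} {d : nat} (f : 'rV[R]_d -> R) (s : R).
Context (xstar : 'rV[R]_d) (x v : nat -> 'rV[R]_d).
Hypothesis s_gt0 : 0 < s.
Hypothesis f_smooth : smooth_convex s^-1 f.
Hypothesis xstar_min : minimizer f xstar.
Hypothesis xv_algorithm : algorithm f s x v.

Local Notation g k := (grad f (x k)).
Local Notation E := (energy f s xstar x v).

(** Clearing the denominator k makes the initialization v 0 = x 1 the case
    k = 0 of the x-update. *)
Lemma algorithm_x_update k :
  2 *: (v k - x k.+1) = k%:R *: (x k.+1 - x k + s *: g k).
Proof.
have [v0 xS _] := xv_algorithm.
case: k => [|k]; first by rewrite v0 subrr scaler0 scale0r.
by rewrite {2}xS// [_ - x _ + _]addrAC subrK [x _ + _]addrC addrK scalerA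
  mulrCA divff ?mulr1.
Qed.

Lemma algorithm_v_update k :
  v k.+1 - xstar = (v k - xstar) - (s * (k%:R + 2) / 2) *: g k.+1.
Proof.
have [_ _ ->] := xv_algorithm.
have -> : s * (k%:R + 2) / 2 = 2^-1 * s * k%:R + s by field.
rewrite scalerDl opprD addrA [LHS]addrAC; congr (_ - _); exact: addrAC.
Qed.

(** Expanding |v_(k+1) - xstar|^2 produces <g_(k+1), v_k - xstar>.  Splitting
    v_k - xstar at x_(k+1) turns this, by the x-update, into the two inner
    products <g_(k+1), x_(k+1) - xstar> and <g_(k+1), x_(k+1) - x_k>, which
    the interpolation inequality bounds from below by differences of f. *)
Lemma energy_step k :
  E k.+1 + s ^+ 2 * k%:R * (k%:R + 2) / 8 * dot (g k) (g k) <= E k.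
Proof.
have si0 : 0 < s^-1 by rewrite invr_gt0.
have K0 : 0 <= k%:R :> R by [].
have at_xstar : f (x k.+1) - f xstar + s / 2 * dot (g k.+1) (g k.+1)
    <= dot (g k.+1) (x k.+1 - xstar).
  have := cocoercive f s^-1 (x k.+1) xstar si0 f_smooth.
  rewrite (grad_minimizer _ _ _ si0 f_smooth xstar_min) subr0.
  rewrite -[xstar - _]opprB dotNr invfM invrK; lra.
have at_xk : f (x k.+1) - f (x k)
    + s / 2 * (dot (g k.+1) (g k.+1) - 2 * dot (g k.+1) (g k) + dot (g k) (g k))
    <= dot (g k.+1) (x k.+1 - x k).
  have := cocoercive f s^-1 (x k.+1) (x k) si0 f_smooth.
  rewrite -[x k - _]opprB dotNr invfM invrK.
  rewrite -[X in g _ - X]scale1r dot_sqrBZ (dotC (g k)); lra.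
have inner : 2 * dot (g k.+1) (v k - x k.+1)
    = k%:R * (dot (g k.+1) (x k.+1 - x k) + s * dot (g k.+1) (g k)).
  by rewrite -dotZr algorithm_x_update dotZr dotDr dotZr.
have split : dot (g k.+1) (v k - xstar)
    = dot (g k.+1) (v k - x k.+1) + dot (g k.+1) (x k.+1 - xstar).
  by rewrite -dotDr addrA subrK.
rewrite /energy algorithm_v_update dot_sqrBZ split -natr1 -subr_ge0.
have := xstar_min (x k.+1).
move: at_xstar at_xk inner; clear split.
move: (dot (g k.+1) (v k - x k.+1)) (dot (g k.+1) (x k.+1 - xstar)) => Q S.
move: (dot (g k.+1) (x k.+1 - x k)) (dot (g k.+1) (g k)) => T U.
move: (dot (g k.+1) (g k.+1)) (dot (g k) (g k)) => G1 G0.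
move: (dot (v k - xstar) (v k - xstar)) => W.
move: (f (x k.+1)) (f (x k)) (f xstar) => f1 f0 fs.
move: (k%:R : R) K0 => K K0.
rewrite -subr_ge0 -[f1 - f0 + _ <= T]subr_ge0 -[fs <= f1]subr_ge0.
move=> at_xstar at_xk inner gap.
have -> : Q = K * (T + s * U) / 2 by rewrite -inner; field.
(* The slack is the sum of the two interpolation inequalities with weights
   s (k+2) / 2 and s k (k+2) / 4, and of s/4 * F_(k+1), left over because
   (k+2)^2 exceeds (k+1)(k+3) by one. *)
rewrite [X in 0 <= X](_ : _ =
  s * (K + 2) / 2 * (S - (f1 - fs + s / 2 * G1))
  + s * K * (K + 2) / 4 * (T - (f1 - f0 + s / 2 * (G1 - 2 * U + G0)))
  + s / 4 * (f1 - fs)); last by field.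
have K2 : 0 <= K + 2 by rewrite addr_ge0.
by rewrite !addr_ge0 ?mulr_ge0 ?divr_ge0 ?mulr_ge0 ?(ltW s_gt0).
Qed.

Lemma energy_telescope k :
  E k + s ^+ 2 / 8 * \sum_(0 <= i < k) i%:R * (i%:R + 2) * dot (g i) (g i)
  <= dot (x 1%N - xstar) (x 1%N - xstar) / 2.
Proof.
elim: k => [|k IHk].
  have [v0 _ _] := xv_algorithm.
  by rewrite big_nil /energy v0 !mulr0 !mul0r add0r addr0.
apply: le_trans IHk; rewrite big_nat_recr//= mulrDr.
have := energy_step k; lra.
Qed.

End Energy.

(** * The two rates *)

Lemma sum_weights {R : realType} (k : nat) :
  \sum_(0 <= i < k) (i%:R * (i%:R + 2)) =
    k%:R * (k%:R - 1) * (2 * k%:R + 5) / 6 :> R.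
Proof.
elim: k => [|k IHk]; first by rewrite big_nil !mul0r.
by rewrite big_nat_recr//= IHk -natr1; field.
Qed.

Theorem theorem6 (R : realType) (d : nat) (L s : R) (f : 'rV[R]_d -> R)
    (xstar : 'rV[R]_d) (x v : nat -> 'rV[R]_d)
    (hL : 0 < L) (hf : smooth_convex L f) (hmin : minimizer f xstar)
    (hs0 : 0 < s) (hsL : s <= 1 / L) (halg : algorithm f s x v) :
  (forall k : nat, (2 <= k)%N ->
     k%:R ^+ 3 * s ^+ 2 / 12 *
       \big[Num.min/enorm (grad f (x 0%N)) ^+ 2]_(0 <= i < k)
          enorm (grad f (x i)) ^+ 2
     <= enorm (x 1%N - xstar) ^+ 2) /\
  (forall k : nat, (1 <= k)%N ->
     s * k%:R * (k%:R + 2) / 2 * (f (x k) - f xstar)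
     <= enorm (x 1%N - xstar) ^+ 2).
Proof.
have si0 : 0 < s^-1 by rewrite invr_gt0.
have f_smooth : smooth_convex s^-1 f.
  apply: smooth_convex_weaken hf.
  by rewrite -[L]invrK lef_pV2 ?posrE ?invr_gt0// -div1r.
have tele := energy_telescope f s xstar x v hs0 f_smooth hmin halg.
split=> k hk; have := tele k; rewrite (enorm_sqr (x 1%N - xstar)).
- set m := \big[Num.min/_]_(_ <= _ < _) _.
  have m0 : 0 <= m.
    by apply: (le_bigmin (index_iota 0 k)) => [|i _]; rewrite enorm_sqr dot_ge0.
  have sum_ge : m * (k%:R * (k%:R - 1) * (2 * k%:R + 5) / 6)
      <= \sum_(0 <= i < k) i%:R * (i%:R + 2) * dot (grad f (x i)) (grad f (x i)).
    rewrite -sum_weights mulr_sumr; apply: ler_sum_nat => i ik.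
    rewrite mulrC ler_wpM2l ?mulr_ge0 ?addr_ge0// -enorm_sqr.
    by rewrite /m; apply: ge_bigmin_seq; rewrite ?mem_index_iota.
  have E0 : 0 <= energy f s xstar x v k.
    rewrite addr_ge0 ?divr_ge0 ?dot_ge0// mulr_ge0 ?subr_ge0//.
    by rewrite divr_ge0 ?mulr_ge0 ?addr_ge0 ?(ltW hs0).
  have k2 : 2 <= k%:R :> R by rewrite ler_nat.
  have weights : k%:R ^+ 3 / 3 <= k%:R * (k%:R - 1) * (2 * k%:R + 5) / 6 :> R.
    nra.
  have mweights := ler_wpM2l m0 weights.
  have s8 : 0 <= s ^+ 2 / 8 by rewrite divr_ge0 ?sqr_ge0.
  have := ler_wpM2l s8 (le_trans mweights sum_ge).
  lra.
- have : 0 <= s ^+ 2 / 8 *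
      \sum_(0 <= i < k) i%:R * (i%:R + 2) * dot (grad f (x i)) (grad f (x i)).
    rewrite mulr_ge0 ?divr_ge0 ?sqr_ge0//; apply: sumr_ge0 => i _.
    by rewrite !mulr_ge0 ?addr_ge0 ?dot_ge0.
  have := dot_ge0 (v k - xstar); rewrite /energy; lra.
Qed.
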